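(* Let $(E,\mu)$ and $(F,\nu)$ be fuzzy Riesz spaces with $F$ fuzzy Dedekind complete, and let $T:E\rightarrow F$ be a fuzzy order bounded operator. Then: (1) $T$ is fuzzy order continuous if and only if the fuzzy null ideal $N_S$ is a fuzzy band for every operator $S$ in the fuzzy ideal $A_T$ generated by $T$ in $FL_b(E,F)$; (2) $T$ is fuzzy $\sigma$-order continuous if and only if the fuzzy null ideal $N_S$ is a fuzzy $\sigma$-ideal for every $S\in A_T$.
   Context: A fuzzy order on a real vector space $E$ is a map $\mu:E\times E\to[0,1]$ with $\mu(x,x)=1$; $\mu(x,y)+\mu(y,x)>1$ implies $x=y$; and $\mu(x,z)\ge\sup_{y}\min(\mu(x,y),\mu(y,z))$. Write $x\le y$ for $\mu(x,y)>\frac12$; upper bounds, suprema and infima are taken with respect to this relation. $(E,\mu)$ is a fuzzy ordered linear space if $\mu(x_1,x_2)>\frac12$ implies $\mu(x_1,x_2)\le\mu(x_1+x,x_2+x)$ for all $x$ and $\mu(x_1,x_2)\le\mu(\alpha x_1,\alpha x_2)$ for all $\alpha>0$; it is a fuzzy Riesz space if $x\vee y=\sup\{x,y\}$, $x\wedge y=\inf\{x,y\}$ exist for all $x,y$; it is fuzzy Dedekind complete if every nonempty subset bounded above has a supremum. $|x|=x\vee(-x)$. A subset is fuzzy order bounded if it has an upper and a lower bound. A linear operator $T:E\to F$ is fuzzy positive if $0\le x$ implies $0\le Tx$, and fuzzy order bounded if it maps fuzzy order bounded sets to fuzzy order bounded sets; $FL_b(E,F)$ is the space of fuzzy order bounded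 operators, ordered by $S\le T$ iff $T-S$ is fuzzy positive; for $F$ fuzzy Dedekind complete it is a fuzzy Riesz space, $|S|$ denotes the modulus of $S$ in it, and $A_T$ is the smallest fuzzy ideal of $FL_b(E,F)$ containing $T$. The fuzzy null ideal of $S$ is $N_S=\{x\in E: |S|(|x|)=0\}$. A fuzzy ideal is a vector subspace $A$ such that $\mu(|x|,|y|)>\frac12$ and $y\in A$ imply $x\in A$; a fuzzy band is a fuzzy ideal containing the supremum (in $E$) of each of its subsets having a supremum; a fuzzy $\sigma$-ideal is a fuzzy ideal $A$ such that $0\le x_n\in A$, $x_n\uparrow x$ imply $x\in A$. $y_\alpha\downarrow 0$ means the net is decreasing with infimum $0$. A net $x_\alpha$ fuzzy order converges to $x$ if there is a net $y_\alpha$ (same index set) with $y_\alpha\downarrow0$ and $\mu(|x_\alpha-x|,y_\alpha)>\frac12$ for all $\alpha$. $T$ is fuzzy order continuous if $x_\alpha\to0$ in fuzzy order (nets) implies $Tx_\alpha\to0$ in fuzzy order, and fuzzy $\sigma$-order continuous if the same holds for sequences. *)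

(* Defs.v *)
From HB Require Import structures.
From mathcomp Require Import all_boot all_order all_algebra.
From mathcomp Require Import reals.
From Stdlib Require Import ClassicalEpsilon.
Set Implicit Arguments. Unset Strict Implicit. Unset Printing Implicit Defensive.
Import Order.TTheory GRing.Theory Num.Theory.
Local Open Scope ring_scope.

Section Fuzzy.
Variable R : realType.

Section Space.
Variable E : lmodType R.
Variable mu : E -> E -> R.

(* fuzzy order; the sup-transitivity  mu(x,z) >= sup_y min(mu(x,y),mu(y,z))
   is written out pointwise (the set is bounded in [0,1]). *)
Definition fuzzy_order : Prop :=
  [/\ (forall x y, 0 <= mu x y <= 1),
      (forall x, mu x x = 1),
      (forall x y, 1 < mu x y + mu y x -> x = y) &
      (forall x y z, Num.min (mu x y) (mu y z) <= mu x z)].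

Definition fle (x y : E) : Prop := 2^-1 < mu x y.

Definition is_ub (A : E -> Prop) (u : E) := forall a, A a -> fle a u.
Definition is_lb (A : E -> Prop) (l : E) := forall a, A a -> fle l a.
Definition is_sup (A : E -> Prop) (s : E) :=
  is_ub A s /\ forall u, is_ub A u -> fle s u.
Definition is_inf (A : E -> Prop) (i : E) :=
  is_lb A i /\ forall l, is_lb A l -> fle l i.

Definition pair2 (x y : E) : E -> Prop := fun z => z = x \/ z = y.

Definition fuzzy_ordered_linear : Prop :=
  fuzzy_order /\
  forall x1 x2, fle x1 x2 ->
    (forall x, mu x1 x2 <= mu (x1 + x) (x2 + x)) /\
    (forall a : R, 0 < a -> mu x1 x2 <= mu (a *: x1) (a *: x2)).

Definition fuzzy_riesz : Prop :=
  fuzzy_ordered_linear /\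
  forall x y, (exists s, is_sup (pair2 x y) s) /\ (exists i, is_inf (pair2 x y) i).

Definition fuzzy_dedekind_complete : Prop :=
  forall A : E -> Prop, (exists a, A a) -> (exists u, is_ub A u) ->
    exists s, is_sup A s.

(* supremum (chosen; unique by antisymmetry when it exists) *)
Definition fsup (A : E -> Prop) : E := epsilon (inhabits 0) (is_sup A).
Definition fjoin (x y : E) : E := fsup (pair2 x y).
Definition fabs (x : E) : E := fjoin x (- x).

Definition fbounded (A : E -> Prop) : Prop :=
  (exists u, is_ub A u) /\ (exists l, is_lb A l).

Definition subspace (A : E -> Prop) : Prop :=
  [/\ A 0, (forall x y, A x -> A y -> A (x + y)) &
      (forall (a : R) x, A x -> A (a *: x))].

Definition fideal (A : E -> Prop) : Prop :=
  subspace A /\ forall x y, fle (fabs x) (fabs y) -> A y -> A x.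

Definition fband (A : E -> Prop) : Prop :=
  fideal A /\
  forall (B : E -> Prop) s, (forall x, B x -> A x) -> is_sup B s -> A s.

Definition seq_up (xs : nat -> E) (x : E) : Prop :=
  (forall n m, (n <= m)%N -> fle (xs n) (xs m)) /\
  is_sup (fun z => exists n, z = xs n) x.

Definition fsigma_ideal (A : E -> Prop) : Prop :=
  fideal A /\
  forall (xs : nat -> E) x, (forall n, fle 0 (xs n) /\ A (xs n)) ->
    seq_up xs x -> A x.

Definition directed (I : Type) (le : I -> I -> Prop) : Prop :=
  [/\ (exists i : I, True), (forall i, le i i),
      (forall i j k, le i j -> le j k -> le i k) &
      (forall i j, exists k, le i k /\ le j k)].

Definition net_down0 (I : Type) (le : I -> I -> Prop) (y : I -> E) : Prop :=
  (forall a b, le a b -> fle (y b) (y a)) /\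
  is_inf (fun z => exists a, z = y a) 0.

Definition fo_conv (I : Type) (le : I -> I -> Prop) (xs : I -> E) (x : E) : Prop :=
  exists y : I -> E, net_down0 le y /\ forall a, fle (fabs (xs a - x)) (y a).

End Space.

Section Operators.
Variables E F : lmodType R.
Variable mu : E -> E -> R.
Variable nu : F -> F -> R.

Definition islinear (T : E -> F) : Prop :=
  forall (a : R) x y, T (a *: x + y) = a *: T x + T y.

Definition fpositive (T : E -> F) : Prop :=
  forall x, fle mu 0 x -> fle nu 0 (T x).

Definition FLb (T : E -> F) : Prop :=
  islinear T /\
  forall A : E -> Prop, fbounded mu A ->
    fbounded nu (fun z => exists x, A x /\ z = T x).

Definition op_le (S T : E -> F) : Prop := fpositive (fun x => T x - S x).

Definition is_op_sup (A : (E -> F) -> Prop) (M : E -> F) : Prop :=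
  [/\ FLb M, (forall S, A S -> op_le S M) &
      (forall U, FLb U -> (forall S, A S -> op_le S U) -> op_le M U)].

Definition opabs (S : E -> F) : E -> F :=
  epsilon (inhabits (fun _ => 0))
    (is_op_sup (fun U => U = S \/ U = (fun x => - S x))).

Definition op_ideal (J : (E -> F) -> Prop) : Prop :=
  [/\ (forall S, J S -> FLb S),
      J (fun _ => 0),
      (forall S U, J S -> J U -> J (fun x => S x + U x)),
      (forall (a : R) S, J S -> J (fun x => a *: S x)) &
      (forall S U, FLb S -> op_le (opabs S) (opabs U) -> J U -> J S)].

Definition gen_ideal (T : E -> F) : (E -> F) -> Prop :=
  fun S => FLb S /\ forall J, op_ideal J -> J T -> J S.

Definition null_ideal (S : E -> F) : E -> Prop :=
  fun x => opabs S (fabs mu x) = 0.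

Definition f_order_continuous (T : E -> F) : Prop :=
  forall (I : Type) (le : I -> I -> Prop), directed le ->
    forall xs : I -> E, fo_conv mu le xs 0 -> fo_conv nu le (fun a => T (xs a)) 0.

Definition f_sigma_order_continuous (T : E -> F) : Prop :=
  forall xs : nat -> E, fo_conv mu (fun n m => (n <= m)%N) xs 0 ->
    fo_conv nu (fun n m => (n <= m)%N) (fun n => T (xs n)) 0.

End Operators.
End Fuzzy.

(* Main.v *)
Require Import Defs.
From HB Require Import structures.
From mathcomp Require Import all_boot all_order all_algebra.
From mathcomp Require Import reals.
From mathcomp Require Import ring lra.
From Stdlib Require Import ClassicalEpsilon.
Set Implicit Arguments. Unset Strict Implicit. Unset Printing Implicit Defensive.
Import Order.TTheory GRing.Theory Num.Theory.
Local Open Scope ring_scope.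

(** The relation [mu x y > 1/2] is a vector lattice order, so the theorem is the classical
    one for order bounded operators into a Dedekind complete Riesz space.  If [T] is order
    continuous, the operators [S] with [|S| y_i] decreasing to [0] whenever [y_i] does form
    an ideal containing [T], and for such [S] a set of elements of [N_S] can be replaced by
    the increasing net of all elements of [N_S] below its supremum.  Conversely, a net
    [y_i] decreasing to [0] is handled by cutting [|T|] down to the ideal generated by the
    elements [(d x - y_i)^+] and using the null ideal of the remaining part of [|T|].
    Sequences are the nets indexed by [nat]. *)

(* Linear identities in a module: syntactic equality of the coefficients of each atom. *)
Section ModuleExpressions.
Variables (K : nzRingType) (V : lmodType K).

Inductive mexp : Type :=
| MVar of nat | MZero | MAdd of mexp & mexp | MOpp of mexp | MScale of K & mexp.

Fixpoint meval (env : seq V) (e : mexp) : V :=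
  match e with
  | MVar i => env`_i
  | MZero => 0
  | MAdd e1 e2 => meval env e1 + meval env e2
  | MOpp e1 => - meval env e1
  | MScale a e1 => a *: meval env e1
  end.

Fixpoint mcoef (i : nat) (e : mexp) : K :=
  match e with
  | MVar j => if i == j then 1 else 0
  | MZero => 0
  | MAdd e1 e2 => mcoef i e1 + mcoef i e2
  | MOpp e1 => - mcoef i e1
  | MScale a e1 => a * mcoef i e1
  end.

Lemma meval_mcoef env e : meval env e = \sum_(i < size env) mcoef i e *: env`_i.
Proof.
elim: e => [j||e1 IH1 e2 IH2|e IH|a e IH] /=.
- have [lt_j|le_j] := ltnP j (size env).
    rewrite (bigD1 (Ordinal lt_j)) //= eqxx scale1r big1 ?addr0 // => i.
    by rewrite -val_eqE /= => /negbTE ->; rewrite scale0r.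
  rewrite nth_default // big1 // => i _.
  by rewrite ltn_eqF ?scale0r // (leq_trans (ltn_ord i)).
- by rewrite big1 // => i _; rewrite scale0r.
- by rewrite IH1 IH2 -big_split; apply: eq_bigr => i _; rewrite /= scalerDl.
- by rewrite IH -sumrN; apply: eq_bigr => i _; rewrite scaleNr.
- by rewrite IH scaler_sumr; apply: eq_bigr => i _; rewrite scalerA.
Qed.

(** Recursive on the number of atoms, so that simplification leaves one scalar identity per atom. *)
Fixpoint mcoef_eq (n : nat) (e1 e2 : mexp) : Prop :=
  match n with
  | 0 => True
  | m.+1 => mcoef m e1 = mcoef m e2 /\ mcoef_eq m e1 e2
  end.

Lemma meval_eq env e1 e2 : mcoef_eq (size env) e1 e2 -> meval env e1 = meval env e2.
Proof.
move=> coefE; rewrite !meval_mcoef; apply: eq_bigr => i _; congr (_ *: _).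
case: i => i /=; elim: (size env) coefE => //= n IH [eq_n eq_lt].
by rewrite ltnS leq_eqVlt => /orP[/eqP -> //|]; apply: IH.
Qed.

End ModuleExpressions.

(** An alias of equality whose implicit arguments are inferred by [change]; this gives the tactics
    the scalar ring and the module structure. *)
Definition module_eq (K : nzRingType) (V : lmodType K) (x y : V) : Prop := x = y.

Ltac mexp_index x env :=
  lazymatch env with
  | x :: _ => constr:(0%N)
  | _ :: ?env' => let n := mexp_index x env' in constr:(S n)
  end.
Ltac mexp_atoms env t :=
  lazymatch t with
  | (?a + ?b)%R => let env1 := mexp_atoms env a in mexp_atoms env1 b
  | (- ?a)%R => mexp_atoms env a
  | (_ *: ?a)%R => mexp_atoms env a
  | 0%R => env
  | ?x => match constr:(tt) with
          | _ => let _ := mexp_index x env in env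
          | _ => constr:(x :: env)
          end
  end.
Ltac mexp_reify K env t :=
  lazymatch t with
  | (?a + ?b)%R => let ea := mexp_reify K env a in
                   let eb := mexp_reify K env b in constr:(MAdd ea eb)
  | (- ?a)%R => let ea := mexp_reify K env a in constr:(MOpp ea)
  | (?c *: ?a)%R => let ea := mexp_reify K env a in constr:(@MScale K c ea)
  | 0%R => constr:(@MZero K)
  | ?x => let n := mexp_index x env in constr:(@MVar K n)
  end.
Ltac lmodule_with tac :=
  lazymatch goal with |- ?l = ?r => change (module_eq l r) end;
  lazymatch goal with
  | |- @module_eq ?K ?V ?l ?r =>
      let env0 := mexp_atoms (@nil V) l in
      let env := mexp_atoms env0 r in
      let el := mexp_reify K env l in
      let er := mexp_reify K env r in
      apply: (@meval_eq K V env el er); rewrite /=; repeat split; tac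
  end.
Ltac lmodule := lmodule_with ltac:(ring).
Ltac lmodule_field := lmodule_with ltac:(by field).

(** * Inequalities, nets and the Archimedean property in an ordered linear space *)

Section OrderedSpace.
Variables (R : realType) (E : lmodType R) (mu : E -> E -> R).
Hypothesis muE : fuzzy_ordered_linear mu.
Local Notation "x <=[] y" := (fle mu x y) (at level 70, no associativity).

Lemma fle_refl x : x <=[] x.
Proof. by case: muE => -[_ mu1 _ _] _; rewrite /fle mu1; lra. Qed.

Lemma fle_trans y x z : x <=[] y -> y <=[] z -> x <=[] z.
Proof.
case: muE => -[_ _ _ mu_min] _; rewrite /fle => lt_xy lt_yz.
by apply: lt_le_trans (mu_min x y z); rewrite lt_min lt_xy.
Qed.

Lemma fle_anti x y : x <=[] y -> y <=[] x -> x = y.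
Proof. by case: muE => -[_ _ mu_anti _] _; rewrite /fle => ? ?; apply: mu_anti; lra. Qed.

Lemma fle_add2r z x y : x <=[] y -> x + z <=[] y + z.
Proof. by case: muE => _ mu_lin le_xy; apply: (lt_le_trans le_xy); apply: (mu_lin _ _ le_xy).1. Qed.

Lemma fle_scale a x y : 0 <= a -> x <=[] y -> a *: x <=[] a *: y.
Proof.
rewrite le_eqVlt => /orP[/eqP <- _|lt0a le_xy]; first by rewrite !scale0r; apply: fle_refl.
by case: muE => _ mu_lin; apply: (lt_le_trans le_xy); apply: (mu_lin _ _ le_xy).2.
Qed.

(** Linear arithmetic for the order: exhibiting a difference as a nonnegative combination of known
    differences leaves a module identity for [lmodule]. *)
Lemma fle_comb1 a x1 y1 x y :
  0 <= a -> x1 <=[] y1 -> y - x = a *: (y1 - x1) -> x <=[] y.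
Proof.
move=> le0a le1 def_y; have := fle_add2r (x - a *: x1) (fle_scale le0a le1).
have -> : a *: x1 + (x - a *: x1) = x by lmodule.
suff -> : a *: y1 + (x - a *: x1) = y by [].
by rewrite -[RHS](subrK x) def_y; lmodule.
Qed.

Lemma fle_comb2 a b x1 y1 x2 y2 x y :
  0 <= a -> 0 <= b -> x1 <=[] y1 -> x2 <=[] y2 ->
  y - x = a *: (y1 - x1) + b *: (y2 - x2) -> x <=[] y.
Proof.
move=> le0a le0b le1 le2 def_y; apply: (@fle_trans (x + a *: (y1 - x1))).
  by apply: (fle_comb1 le0a le1); lmodule.
apply: fle_comb1 le0b le2 _.
by rewrite opprD addrA def_y; lmodule.
Qed.

Lemma fle_sum1 x1 y1 x y : x1 <=[] y1 -> y - x = y1 - x1 -> x <=[] y.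
Proof. by move=> le1 def_y; apply: fle_comb1 ler01 le1 _; rewrite scale1r. Qed.

Lemma fle_sum2 x1 y1 x2 y2 x y :
  x1 <=[] y1 -> x2 <=[] y2 -> y - x = (y1 - x1) + (y2 - x2) -> x <=[] y.
Proof. by move=> le1 le2 def_y; apply: fle_comb2 ler01 ler01 le1 le2 _; rewrite !scale1r. Qed.

Lemma fge0_scale a x : 0 <= a -> 0 <=[] x -> 0 <=[] a *: x.
Proof. by move=> le0a le0x; apply: fle_comb1 le0a le0x _; lmodule. Qed.

Lemma fge0_add x y : 0 <=[] x -> 0 <=[] y -> 0 <=[] x + y.
Proof. by move=> le0x le0y; apply: fle_sum2 le0x le0y _; lmodule. Qed.

Lemma is_sup_unique A s t : is_sup mu A s -> is_sup mu A t -> s = t.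
Proof. by case=> us ls [ut lt]; apply: fle_anti; [apply: ls|apply: lt]. Qed.

Lemma fsupP A : (exists s, is_sup mu A s) -> is_sup mu A (fsup mu A).
Proof. by move=> ex_s; apply: epsilon_spec. Qed.

Section Net.
Variables (I : Type) (le : I -> I -> Prop).
Hypothesis leI : directed le.

(** By directedness every index [i] has some [k] above both [i] and [i0], so a lower bound of the
    tail is one of the whole net. *)
Lemma net_down0_tail (p : I -> E) (g : E) i0 :
  net_down0 mu le p -> (forall i, le i0 i -> g <=[] p i) -> g <=[] 0.
Proof.
move=> [p_dec [_ p_inf]] g_le; apply: p_inf => _ [i ->].
case: leI => _ _ _ /(_ i i0) [k [le_ik le_i0k]].
by apply: fle_trans (g_le k le_i0k) _; apply: p_dec.
Qed.

Lemma net_down0_ge0 (p : I -> E) i : net_down0 mu le p -> 0 <=[] p i.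
Proof. by case=> _ [lb _]; apply: lb; exists i. Qed.

Lemma net_up_sub (d : I -> E) s :
  (forall i j, le i j -> d i <=[] d j) -> is_sup mu (fun z => exists i, z = d i) s ->
  net_down0 mu le (fun i => s - d i).
Proof.
move=> d_inc [ub lub]; split=> [i j le_ij|].
  by apply: fle_sum1 (d_inc _ _ le_ij) _; lmodule.
split=> [_ [i ->]|l lb].
  by apply: (@fle_sum1 (d i) s); [apply: ub; exists i|lmodule].
apply: (@fle_sum1 s (s - l)); last by lmodule.
apply: lub => _ [i ->].
by apply: (@fle_sum1 l (s - d i)); [apply: lb; exists i|lmodule].
Qed.

End Net.

(** Adding [g] to one of these multiples gives the next one, so their supremum [s] satisfies
    [s <= s - g]. They start at [2] because the reciprocal of the factor has to be below [1] in the
    application. *)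
Lemma dedekind_archimedean g h :
  fuzzy_dedekind_complete mu -> (forall n, n.+2%:R *: g <=[] h) -> g <=[] 0.
Proof.
move=> DC ub_h.
have [||s [ub lub]] := DC (fun z => exists n : nat, z = n.+2%:R *: g).
- by exists (2 *: g), 0%N.
- by exists h => _ [n ->].
have le_s : s <=[] s - g.
  apply: lub => _ [n ->].
  apply: (@fle_sum1 (n.+3%:R *: g) s); first by apply: ub; exists n.+1.
  by rewrite -[n.+3]addn1 natrD; lmodule.
by apply: fle_sum1 le_s _; lmodule.
Qed.

End OrderedSpace.

(** * Positive parts and moduli in a Riesz space *)

Section RieszSpace.
Variables (R : realType) (E : lmodType R) (mu : E -> E -> R).
Hypothesis muR : fuzzy_riesz mu.
Local Notation "x <=[] y" := (fle mu x y) (at level 70, no associativity).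
Local Notation abs := (fabs mu).
Let muE : fuzzy_ordered_linear mu := muR.1.

Definition fpos (x : E) : E := fjoin mu x 0.

Lemma fjoinP x y :
  [/\ x <=[] fjoin mu x y, y <=[] fjoin mu x y &
      forall u, x <=[] u -> y <=[] u -> fjoin mu x y <=[] u].
Proof.
have [ub lub] := fsupP (muR.2 x y).1.
split; [by apply: ub; left|by apply: ub; right|].
by move=> u le_xu le_yu; apply: lub => _ [->|->].
Qed.

Lemma fpos_ge x : x <=[] fpos x. Proof. by case: (fjoinP x 0). Qed.
Lemma fpos_ge0 x : 0 <=[] fpos x. Proof. by case: (fjoinP x 0). Qed.
Lemma fpos_le x u : x <=[] u -> 0 <=[] u -> fpos x <=[] u.
Proof. by case: (fjoinP x 0) => _ _ lub; apply: lub. Qed.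
Lemma fabs_ge x : x <=[] abs x. Proof. by case: (fjoinP x (- x)). Qed.
Lemma fabs_geN x : - x <=[] abs x. Proof. by case: (fjoinP x (- x)). Qed.
Lemma fabs_le x u : x <=[] u -> - x <=[] u -> abs x <=[] u.
Proof. by case: (fjoinP x (- x)) => _ _ lub; apply: lub. Qed.

Lemma fabs_ge0 x : 0 <=[] abs x.
Proof.
have half_ge0 : 0 <= 2^-1 :> R by lra.
by apply: (fle_comb2 muE half_ge0 half_ge0 (fabs_ge x) (fabs_geN x)); lmodule_field.
Qed.

Lemma fabs_pos x : 0 <=[] x -> abs x = x.
Proof.
move=> x_ge0; apply: (fle_anti muE (fabs_le _ _) (fabs_ge x)); first exact: fle_refl.
by apply: (fle_comb1 muE _ x_ge0 (a := 2)) => //; lmodule.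
Qed.

Lemma fpos_mono x y : x <=[] y -> fpos x <=[] fpos y.
Proof. by move=> le_xy; apply: fpos_le (fle_trans muE le_xy (fpos_ge y)) (fpos_ge0 y). Qed.

(* [q^+] and [q^-] are disjoint, so nothing positive lies below a multiple of both. *)
Lemma fle0_disjoint t q k : 0 <= k -> t <=[] - q -> t <=[] k *: fpos q -> t <=[] 0.
Proof.
move=> le0k le_tNq le_tq; set m := fpos t.
(* Here [m - t] is the negative part of [t]. With [t <= k *: fpos q] this gives
   [(1 + k) *: t <= k *: m], so [m] lies below a multiple of itself with factor less than [1]. *)
have le_q : fpos q <=[] m - t.
  apply: fpos_le.
    by apply: (fle_sum2 muE le_tNq (fpos_ge0 t)); rewrite -/m; lmodule.
  by apply: (fle_sum1 muE (fpos_ge t)); rewrite -/m; lmodule.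
have k1_gt0 : 0 < (1 + k)^-1 by rewrite invr_gt0; lra.
have k1_neq0 : 1 + k != 0 by apply: lt0r_neq0; lra.
have le_m : m <=[] (k / (1 + k)) *: m.
  apply: fpos_le; last first.
    by apply: (fge0_scale muE _ (fpos_ge0 t)); apply: divr_ge0; lra.
  apply: (fle_comb2 muE (ltW k1_gt0) (mulr_ge0 (ltW k1_gt0) le0k) le_tq le_q).
  by lmodule_field.
apply: (fle_trans muE (fpos_ge t)).
apply: (fle_comb1 muE _ le_m (a := 1 + k)); first by lra.
by rewrite -/m; lmodule_field.
Qed.

End RieszSpace.

(** * Linear, positive and order bounded operators *)

Section Operators.
Variables (R : realType) (E F : lmodType R) (mu : E -> E -> R) (nu : F -> F -> R).
Hypotheses (muR : fuzzy_riesz mu) (nuR : fuzzy_riesz nu).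
Let muE : fuzzy_ordered_linear mu := muR.1.
Let nuF : fuzzy_ordered_linear nu := nuR.1.
Local Notation "x <=[] y" := (fle mu x y) (at level 70, no associativity).
Local Notation "x <={} y" := (fle nu x y) (at level 70, no associativity).
Local Notation opabs := (opabs mu nu).
Local Notation FLb := (FLb mu nu).
Implicit Types S T U Q : E -> F.

Lemma linear_op0 T : islinear T -> T 0 = 0.
Proof.
move=> T_lin; have := T_lin 1 0 0; rewrite !scale1r !addr0 => T00.
by apply: (addrI (T 0)); rewrite -T00 addr0.
Qed.

Lemma linear_opD T x y : islinear T -> T (x + y) = T x + T y.
Proof. by move=> T_lin; have := T_lin 1 x y; rewrite !scale1r. Qed.

Lemma linear_opZ T a x : islinear T -> T (a *: x) = a *: T x.
Proof. by move=> T_lin; have := T_lin a x 0; rewrite (linear_op0 T_lin) !addr0. Qed.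

Lemma linear_opN T x : islinear T -> T (- x) = - T x.
Proof. by move=> T_lin; rewrite -scaleN1r linear_opZ // scaleN1r. Qed.

Lemma linear_opB T x y : islinear T -> T (x - y) = T x - T y.
Proof. by move=> T_lin; rewrite linear_opD // linear_opN. Qed.

Lemma islinear_sub S T : islinear S -> islinear T -> islinear (fun x => S x - T x).
Proof. by move=> S_lin T_lin a x y; rewrite S_lin T_lin; lmodule. Qed.

Lemma fpositive_mono T x y :
  islinear T -> fpositive mu nu T -> x <=[] y -> T x <={} T y.
Proof.
move=> T_lin T_pos le_xy.
have /T_pos : 0 <=[] y - x by apply: (fle_sum1 muE le_xy); lmodule.
by rewrite linear_opB // => le0; apply: (fle_sum1 nuF le0); lmodule.
Qed.

Lemma fpositive_FLb T : islinear T -> fpositive mu nu T -> FLb T.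
Proof.
move=> T_lin T_pos; split=> // A [[u ub] [l lb]].
by split; [exists (T u)|exists (T l)] => _ [x [Ax ->]];
  apply: fpositive_mono => //; [apply: ub|apply: lb].
Qed.

Lemma FLb0 : FLb (fun=> 0).
Proof.
apply: fpositive_FLb => [a x y|x _]; first by rewrite scaler0 addr0.
exact: fle_refl nuF _.
Qed.

Lemma FLb_add S T : FLb S -> FLb T -> FLb (fun x => S x + T x).
Proof.
move=> [S_lin S_bd] [T_lin T_bd]; split=> [a x y|A A_bd].
  by rewrite S_lin T_lin; lmodule.
have [[uS ubS] [lS lbS]] := S_bd A A_bd; have [[uT ubT] [lT lbT]] := T_bd A A_bd.
split; [exists (uS + uT)|exists (lS + lT)] => _ [x [Ax ->]].
  have leS : S x <={} uS by apply: ubS; exists x.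
  have leT : T x <={} uT by apply: ubT; exists x.
  by apply: (fle_sum2 nuF leS leT); lmodule.
have leS : lS <={} S x by apply: lbS; exists x.
have leT : lT <={} T x by apply: lbT; exists x.
by apply: (fle_sum2 nuF leS leT); lmodule.
Qed.

Lemma FLb_scale a T : FLb T -> FLb (fun x => a *: T x).
Proof.
move=> [T_lin T_bd]; split=> [b x y|A A_bd].
  by rewrite T_lin; lmodule.
have [[u ub] [l lb]] := T_bd A A_bd.
have {}ub x : A x -> T x <={} u by move=> Ax; apply: ub; exists x.
have {}lb x : A x -> l <={} T x by move=> Ax; apply: lb; exists x.
have [le0a|lta0] := leP 0 a.
  split; [exists (a *: u)|exists (a *: l)] => _ [x [Ax ->]];
    apply: (fle_scale nuF le0a); [exact: ub|exact: lb].
have le0a : 0 <= - a by lra.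
split; [exists (a *: l)|exists (a *: u)] => _ [x [Ax ->]].
  by apply: (fle_comb1 nuF le0a (lb x Ax)); lmodule.
by apply: (fle_comb1 nuF le0a (ub x Ax)); lmodule.
Qed.

(** * Restriction of an operator to an ideal, and the modulus *)

(** Kantorovich's extension: every element is a difference [a - b] of positive ones, and additivity
    makes [p a - p b] independent of the choice of [a] and [b]. *)
Lemma cone_extension (p : E -> F) :
  (forall x y, 0 <=[] x -> 0 <=[] y -> p (x + y) = p x + p y) ->
  (forall a x, 0 < a -> 0 <=[] x -> p (a *: x) = a *: p x) ->
  exists2 Q, islinear Q & forall x, 0 <=[] x -> Q x = p x.
Proof.
move=> pD pZ_gt0.
have ge00 : 0 <=[] 0 by exact: fle_refl muE _.
have p0 : p 0 = 0 by apply: (addrI (p 0)); rewrite -pD // !addr0.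
have pZ a x : 0 <= a -> 0 <=[] x -> p (a *: x) = a *: p x.
  by rewrite le_eqVlt => /orP[/eqP <- _|]; [rewrite !scale0r p0|apply: pZ_gt0].
have [pos [neg [pos_ge0 neg_ge0 posE]]] : exists pos neg : E -> E,
    [/\ forall x, 0 <=[] pos x, forall x, 0 <=[] neg x & forall x, pos x = x + neg x].
  exists (fpos mu), (fun x => fpos mu x - x); split=> x.
  - exact: fpos_ge0 muR x.
  - by apply: (fle_sum1 muE (fpos_ge muR x)); lmodule.
  - by lmodule.
pose Q x := p (pos x) - p (neg x).
have QE a b : 0 <=[] a -> 0 <=[] b -> Q (a - b) = p a - p b.
  move=> a_ge0 b_ge0; set z := a - b.
  have : p (pos z) + p b = p a + p (neg z).
    by rewrite -!pD //; congr p; rewrite posE /z; lmodule.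
  move=> /(congr1 (fun y => y - p b - p (neg z))) pE.
  transitivity (p (pos z) + p b - p b - p (neg z)); first by rewrite /Q; lmodule.
  by rewrite pE; lmodule.
have negE x : x = pos x - neg x by rewrite posE; lmodule.
exists Q => [a x y|x x_ge0]; last by rewrite -[x in LHS]subr0 QE // p0 subr0.
have [le0a|lta0] := leP 0 a.
  have -> : a *: x + y = (a *: pos x + pos y) - (a *: neg x + neg y).
    by rewrite {1}[x]negE {1}[y]negE; lmodule.
  have aZ z : 0 <=[] z -> 0 <=[] a *: z by exact: fge0_scale.
  rewrite QE ?pD ?pZ //; try by [apply: aZ|apply: fge0_add => //; apply: aZ].
  by rewrite /Q; lmodule.
(* A negative scalar exchanges the roles of [pos x] and [neg x]. *)
have le0a : 0 <= - a by lra.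
have -> : a *: x + y = ((- a) *: neg x + pos y) - ((- a) *: pos x + neg y).
  by rewrite {1}[x]negE {1}[y]negE; lmodule.
have aZ z : 0 <=[] z -> 0 <=[] (- a) *: z by exact: fge0_scale.
rewrite QE ?pD ?pZ //; try by [apply: aZ|apply: fge0_add => //; apply: aZ].
by rewrite /Q; lmodule.
Qed.

(** These are the positive cones of the ideals of [E]. *)
Definition solid_cone (C : E -> Prop) : Prop :=
  [/\ C 0, forall w, C w -> 0 <=[] w,
      forall v w, C v -> C w -> C (v + w),
      forall a w, 0 < a -> C w -> C (a *: w) &
      forall v w, 0 <=[] v -> v <=[] w -> C w -> C v].

Hypothesis nuDC : fuzzy_dedekind_complete nu.

(* Additivity of the supremum on positive elements is the Riesz decomposition
   property: [w = (w - (w - x)^+) + (w - x)^+] splits [w <= x + y]. *)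
Lemma FLb_restriction C T : solid_cone C -> FLb T ->
  exists Q, [/\ islinear Q, fpositive mu nu Q &
    forall x, 0 <=[] x -> is_sup nu (fun z => exists w, [/\ C w, w <=[] x & z = T w]) (Q x)].
Proof.
move=> [C0 C_ge0 CD CZ C_solid] [T_lin T_bd].
pose A x z := exists w, [/\ C w, w <=[] x & z = T w].
have supA x : 0 <=[] x -> is_sup nu (A x) (fsup nu (A x)).
  move=> x_ge0; apply: fsupP; apply: nuDC; first by exists (T 0), 0.
  have [|[u ub] _] := T_bd (fun w => 0 <=[] w /\ w <=[] x).
    by split; [exists x => w []|exists 0 => w []].
  by exists u => _ [w [Cw le_wx ->]]; apply: ub; exists w; split=> //; split=> //; apply: C_ge0.
have [x y x_ge0 y_ge0|a x lt0a x_ge0|Q Q_lin QE] := @cone_extension (fun x => fsup nu (A x)).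
- have xy_ge0 := fge0_add muE x_ge0 y_ge0.
  apply: (is_sup_unique nuF (supA _ xy_ge0)).
  have [ubx lubx] := supA x x_ge0; have [uby luby] := supA y y_ge0.
  split=> [_ [w [Cw le_w ->]]|u ub].
    set v := fpos mu (w - x).
    have v_ge0 : 0 <=[] v by exact: fpos_ge0.
    have le_wx : w - x <=[] v by exact: fpos_ge.
    have le_vw : v <=[] w.
      by apply: fpos_le => //; [apply: (fle_sum1 muE x_ge0); lmodule|apply: C_ge0].
    have le_vy : v <=[] y by apply: fpos_le => //; apply: (fle_sum1 muE le_w); lmodule.
    have wv_ge0 : 0 <=[] w - v by apply: (fle_sum1 muE le_vw); lmodule.
    have le_wv : w - v <=[] w by apply: (fle_sum1 muE v_ge0); lmodule.
    have le1 : T (w - v) <={} fsup nu (A x).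
      apply: ubx; exists (w - v); split=> //; first exact: C_solid Cw.
      by apply: (fle_sum1 muE le_wx); lmodule.
    have le2 : T v <={} fsup nu (A y).
      by apply: uby; exists v; split=> //; apply: C_solid Cw.
    by apply: (fle_sum2 nuF le1 le2); rewrite linear_opB //; lmodule.
  (* The bound [T w + T v <= u] is passed to the supremum over [w] with [v] fixed, then over [v]. *)
  have le_u : fsup nu (A y) <={} u - fsup nu (A x).
    apply: luby => _ [v [Cv le_vy ->]].
    have le_x : fsup nu (A x) <={} u - T v.
      apply: lubx => _ [w [Cw le_wx ->]].
      have le_wv : T (w + v) <={} u.
        apply: ub; exists (w + v); split=> //; first exact: CD.
        by apply: (fle_sum2 muE le_wx le_vy); lmodule.
      by apply: (fle_sum1 nuF le_wv); rewrite linear_opD //; lmodule.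
    by apply: (fle_sum1 nuF le_x); lmodule.
  by apply: (fle_sum1 nuF le_u); lmodule.
- have ax_ge0 := fge0_scale muE (ltW lt0a) x_ge0.
  apply: (is_sup_unique nuF (supA _ ax_ge0)).
  have [ub lub] := supA x x_ge0.
  have lt0Va : 0 < a^-1 by rewrite invr_gt0.
  have a_neq0 : a != 0 by exact: lt0r_neq0.
  split=> [_ [w [Cw le_w ->]]|u ubu].
    have le_T : T (a^-1 *: w) <={} fsup nu (A x).
      apply: ub; exists (a^-1 *: w); split=> //; first exact: CZ.
      by apply: (fle_comb1 muE (ltW lt0Va) le_w); lmodule_field.
    by apply: (fle_comb1 nuF (ltW lt0a) le_T); rewrite linear_opZ //; lmodule_field.
  have le_x : fsup nu (A x) <={} a^-1 *: u.
    apply: lub => _ [w [Cw le_w ->]].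
    have le_T : T (a *: w) <={} u.
      by apply: ubu; exists (a *: w); split=> //; [apply: CZ|apply: (fle_scale muE (ltW lt0a))].
    by apply: (fle_comb1 nuF (ltW lt0Va) le_T); rewrite linear_opZ //; lmodule_field.
  by apply: (fle_comb1 nuF (ltW lt0a) le_x); lmodule_field.
- exists Q; split=> // [x x_ge0|x x_ge0]; rewrite QE //; last exact: supA.
  by have [ub _] := supA x x_ge0; apply: ub; exists 0; rewrite linear_op0.
Qed.

(** The modulus is twice the positive part minus [T], where the positive part is the restriction [Q]
    to the cone of all positive elements. The last clause is the pointwise Riesz-Kantorovich
    formula, since [2 *: T a - T x] is [T a - T (x - a)]. *)
Lemma FLb_modulus T : FLb T -> exists M, [/\ islinear M, fpositive mu nu M,
    is_op_sup mu nu (fun U => U = T \/ U = (fun x => - T x)) M &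
    forall x g, 0 <=[] x -> (forall a, 0 <=[] a -> a <=[] x -> 2 *: T a - T x <={} g) ->
      M x <={} g].
Proof.
move=> T_FLb; have [T_lin _] := T_FLb.
have [|Q [Q_lin Q_pos Q_sup]] := @FLb_restriction (fun w => 0 <=[] w) T _ T_FLb.
  split=> //; first exact: fle_refl muE _.
  - by move=> v w; apply: fge0_add.
  - by move=> a w /ltW; apply: fge0_scale.
have M_le x g : 0 <=[] x -> (forall a, 0 <=[] a -> a <=[] x -> 2 *: T a - T x <={} g) ->
    2 *: Q x - T x <={} g.
  move=> x_ge0 le_g; have half_ge0 : 0 <= 2^-1 :> R by lra.
  have le_Q : Q x <={} 2^-1 *: (g + T x).
    apply: (Q_sup x x_ge0).2 => _ [a [a_ge0 le_ax ->]].
    by apply: (fle_comb1 nuF half_ge0 (le_g a a_ge0 le_ax)); lmodule_field.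
  by apply: (fle_comb1 nuF (ler0n _ 2) le_Q); lmodule_field.
have le_TQ x : 0 <=[] x -> T x <={} Q x.
  by move=> x_ge0; apply: (Q_sup x x_ge0).1; exists x; split=> //; exact: fle_refl muE _.
have M_lin : islinear (fun x => 2 *: Q x - T x).
  by move=> a x y; rewrite Q_lin T_lin; lmodule.
have M_pos : fpositive mu nu (fun x => 2 *: Q x - T x).
  by move=> x x_ge0; apply: (fle_sum2 nuF (le_TQ x x_ge0) (Q_pos x x_ge0)); lmodule.
exists (fun x => 2 *: Q x - T x); split=> //; split=> [|_ [->|->] x x_ge0|U [U_lin _] ub].
- exact: fpositive_FLb.
- by apply: (fle_comb1 nuF (ler0n _ 2) (le_TQ x x_ge0)); lmodule.
- by apply: (fle_comb1 nuF (ler0n _ 2) (Q_pos x x_ge0)); lmodule.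
- have leT x : 0 <=[] x -> T x <={} U x.
    by move=> /(ub T (or_introl erefl)) le0; apply: (fle_sum1 nuF le0); lmodule.
  have leNT x : 0 <=[] x -> - T x <={} U x.
    by move=> /(ub _ (or_intror erefl)) le0; apply: (fle_sum1 nuF le0); lmodule.
  move=> x x_ge0; suff le_M : 2 *: Q x - T x <={} U x by apply: (fle_sum1 nuF le_M); lmodule.
  apply: M_le => // a a_ge0 le_ax.
  have xa_ge0 : 0 <=[] x - a by apply: (fle_sum1 muE le_ax); lmodule.
  apply: (fle_sum2 nuF (leT a a_ge0) (leNT _ xa_ge0)).
  by rewrite !linear_opB //; lmodule.
Qed.

Lemma opabs_op_sup T : FLb T ->
  is_op_sup mu nu (fun U => U = T \/ U = (fun x => - T x)) (opabs T).
Proof. by move=> /FLb_modulus [M [_ _ supM _]]; apply: epsilon_spec; exists M. Qed.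

Lemma opabs_FLb T : FLb T -> FLb (opabs T).
Proof. by move=> /opabs_op_sup []. Qed.

Lemma opabs_linear T : FLb T -> islinear (opabs T).
Proof. by move=> /opabs_FLb []. Qed.

Lemma opabs_ge T x : FLb T -> 0 <=[] x -> T x <={} opabs T x.
Proof.
move=> /opabs_op_sup [_ ub _] /(ub T (or_introl erefl)) le0.
by apply: (fle_sum1 nuF le0); lmodule.
Qed.

Lemma opabs_geN T x : FLb T -> 0 <=[] x -> - T x <={} opabs T x.
Proof.
move=> /opabs_op_sup [_ ub _] /(ub _ (or_intror erefl)) le0.
by apply: (fle_sum1 nuF le0); lmodule.
Qed.

Lemma opabs_le T U x : FLb T -> FLb U ->
  (forall y, 0 <=[] y -> T y <={} U y) -> (forall y, 0 <=[] y -> - T y <={} U y) ->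
  0 <=[] x -> opabs T x <={} U x.
Proof.
move=> /opabs_op_sup [_ _ lub] U_FLb leT leNT x_ge0.
have /(_ x x_ge0) le0 : op_le mu nu (opabs T) U.
  apply: lub => // _ [->|->] y y_ge0.
    by apply: (fle_sum1 nuF (leT y y_ge0)); lmodule.
  by apply: (fle_sum1 nuF (leNT y y_ge0)); lmodule.
by apply: (fle_sum1 nuF le0); lmodule.
Qed.

Lemma opabs_fpositive T : FLb T -> fpositive mu nu (opabs T).
Proof.
move=> T_FLb x x_ge0; have half_ge0 : 0 <= 2^-1 :> R by lra.
by apply: (fle_comb2 nuF half_ge0 half_ge0 (opabs_ge T_FLb x_ge0) (opabs_geN T_FLb x_ge0));
  lmodule_field.
Qed.

(** The explicit modulus [M] is an upper bound of [T] and its opposite, so the chosen supremum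
    [opabs T] lies below [M] and inherits its pointwise bound. *)
Lemma opabs_lub T x g : FLb T -> 0 <=[] x ->
  (forall a, 0 <=[] a -> a <=[] x -> 2 *: T a - T x <={} g) -> opabs T x <={} g.
Proof.
move=> T_FLb x_ge0 le_g; have [M [M_lin M_pos [M_FLb ub _] M_le]] := FLb_modulus T_FLb.
apply: (fle_trans nuF _ (M_le x g x_ge0 le_g)); apply: opabs_le => // y y_ge0.
  by apply: (fle_sum1 nuF (ub T (or_introl erefl) y y_ge0)); lmodule.
by apply: (fle_sum1 nuF (ub _ (or_intror erefl) y y_ge0)); lmodule.
Qed.

(* [2 (|T| y - T z) = (|T| - T)(y + z) + (|T| + T)(y - z)] *)
Lemma opabs_bound T y z : FLb T -> z <=[] y -> - z <=[] y -> T z <={} opabs T y.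
Proof.
move=> T_FLb le_zy le_Nzy; have [T_lin _] := T_FLb; have A_lin := opabs_linear T_FLb.
have half_ge0 : 0 <= 2^-1 :> R by lra.
have yz_ge0 : 0 <=[] y - z by apply: (fle_sum1 muE le_zy); lmodule.
have zy_ge0 : 0 <=[] y + z by apply: (fle_sum1 muE le_Nzy); lmodule.
apply: (fle_comb2 nuF half_ge0 half_ge0 (opabs_ge T_FLb zy_ge0) (opabs_geN T_FLb yz_ge0)).
by rewrite !(linear_opD, linear_opN) //; lmodule_field.
Qed.

(** The modulus of [S] is positive and linear, so whatever has its modulus below a zero of [opabs S]
    is null; sums and multiples are dominated in this way. *)
Lemma null_ideal_fideal S : FLb S -> fideal mu (null_ideal mu nu S).
Proof.
move=> S_FLb; have A_lin := opabs_linear S_FLb; have A_pos := opabs_fpositive S_FLb.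
have solid x z : fabs mu x <=[] z -> opabs S z = 0 -> null_ideal mu nu S x.
  move=> le_xz Az0; apply: (fle_anti nuF); last by apply: A_pos; apply: fabs_ge0.
  by rewrite -Az0; apply: fpositive_mono.
split; last by move=> x y le_xy; apply: solid le_xy.
split=> [|x y x_null y_null|a x x_null].
- by rewrite /null_ideal fabs_pos ?linear_op0 //; apply: fle_refl muE _.
- apply: (@solid _ (fabs mu x + fabs mu y)); last by rewrite linear_opD // x_null y_null addr0.
  apply: fabs_le => //.
    by apply: (fle_sum2 muE (fabs_ge muR x) (fabs_ge muR y)); lmodule.
  by apply: (fle_sum2 muE (fabs_geN muR x) (fabs_geN muR y)); lmodule.
- apply: (@solid _ (`|a| *: fabs mu x)); last by rewrite linear_opZ // x_null scaler0.
  have [le0a|lta0] := ger0P a.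
    apply: fabs_le => //.
      exact: (fle_scale muE le0a (fabs_ge muR x)).
    by apply: (fle_comb1 muE le0a (fabs_geN muR x)); lmodule.
  have le0Na : 0 <= - a by lra.
  apply: fabs_le => //.
    by apply: (fle_comb1 muE le0Na (fabs_geN muR x)); lmodule.
  by apply: (fle_comb1 muE le0Na (fabs_ge muR x)); lmodule.
Qed.

(** * Order continuity along nets over a fixed directed set *)

Section Net.
Variables (I : Type) (le : I -> I -> Prop).
Hypothesis leI : directed le.

(** For a positive linear [Q], this is the greatest-lower-bound half of the assertion that [Q (y i)]
    decreases to zero whenever [y] does. *)
Definition vanishing (Q : E -> F) : Prop :=
  forall y, net_down0 mu le y -> forall g, (forall i, g <={} Q (y i)) -> g <={} 0.

Definition net_continuous (T : E -> F) : Prop :=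
  forall xs : I -> E, fo_conv mu le xs 0 -> fo_conv nu le (fun i => T (xs i)) 0.

(* For [0 <= a <= x = y_i0] and [b = (a - y_i)^+], the net [2 (a - b) - y_i] is
   dominated by [y_i], while [2 T b - T (x - y_i) <= |T| (x - y_i)]. *)
Lemma vanishing_opabs T : FLb T -> net_continuous T -> vanishing (opabs T).
Proof.
move=> T_FLb T_cont y y0 g le_g; have [T_lin _] := T_FLb; have A_lin := opabs_linear T_FLb.
have [[i0 _] _ _ _] := leI; set x := y i0.
have y_ge0 i : 0 <=[] y i by exact: net_down0_ge0 y0.
(* In this form the pointwise formula for the modulus applies, and the goal becomes a bound on
   [2 *: T a - T x] for each [a] between [0] and [x]. *)
suff le_A : opabs T x <={} opabs T x - g by apply: (fle_sum1 nuF le_A); lmodule.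
apply: (opabs_lub T_FLb (y_ge0 i0)) => a a_ge0; rewrite -/x => le_ax.
pose b i := fpos mu (a - y i).
have b_ge0 i : 0 <=[] b i by exact: fpos_ge0.
have le_ab i : a - y i <=[] b i by exact: fpos_ge.
have le_ba i : b i <=[] a.
  by apply: fpos_le => //; apply: (fle_sum1 muE (y_ge0 i)); lmodule.
pose z i := 2 *: (a - b i) - y i.
have [p [p0 le_p]] : fo_conv nu le (fun i => T (z i)) 0.
  apply: T_cont; exists y; split=> // i; rewrite subr0; apply: fabs_le => //.
    by apply: (fle_comb1 muE (ler0n _ 2) (le_ab i)); rewrite /z; lmodule.
  by apply: (fle_comb1 muE (ler0n _ 2) (le_ba i)); rewrite /z; lmodule.
suff le0 : 2 *: T a - T x - (opabs T x - g) <={} 0.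
  by apply: (fle_sum1 nuF le0); lmodule.
apply: (net_down0_tail nuF leI (i0 := i0) p0) => i le_i0i.
have le_yx : y i <=[] x by apply: y0.1.
have le_bxy : b i <=[] x - y i.
  apply: fpos_le => //.
    by apply: (fle_sum1 muE le_ax); lmodule.
  by apply: (fle_sum1 muE le_yx); lmodule.
have xyb_ge0 : 0 <=[] x - y i - b i by apply: (fle_sum1 muE le_bxy); lmodule.
have le_T : 2 *: T (b i) - T (x - y i) <={} opabs T (x - y i).
  apply: (fle_sum2 nuF (opabs_geN T_FLb xyb_ge0) (opabs_ge T_FLb (b_ge0 i))).
  by rewrite !(linear_opD, linear_opN) //; lmodule.
(* The left side is at most [T (z i)] by adding [le_T] and [le_g i], and [T (z i)] is at most its
   modulus, hence at most [p i]. *)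
apply: (fle_trans nuF _ (le_p i)); rewrite subr0.
apply: (fle_trans nuF _ (fabs_ge nuR _)).
apply: (fle_sum2 nuF le_T (le_g i)).
by rewrite /z !(linear_opD, linear_opN, linear_opZ) //; lmodule.
Qed.

(** The dominating net is [opabs T (y i)], because [xs i] and its opposite both lie below [y i]. *)
Lemma net_continuous_vanishing T : FLb T -> vanishing (opabs T) -> net_continuous T.
Proof.
move=> T_FLb T_van xs [y [y0 le_y]].
have A_lin := opabs_linear T_FLb; have A_pos := opabs_fpositive T_FLb.
exists (fun i => opabs T (y i)); split=> [|i].
  split=> [i j le_ij|]; first by apply: fpositive_mono => //; apply: y0.1.
  split=> [_ [i ->]|l lb]; first by apply: A_pos; apply: net_down0_ge0 y0.
  by apply: (T_van y y0) => i; apply: lb; exists i.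
have [T_lin _] := T_FLb; have := le_y i; rewrite !subr0 => le_yi.
have le1 := fle_trans muE (fabs_ge muR (xs i)) le_yi.
have le2 := fle_trans muE (fabs_geN muR (xs i)) le_yi.
apply: fabs_le => //; first exact: opabs_bound.
by rewrite -linear_opN //; apply: opabs_bound; rewrite ?opprK.
Qed.

(** The net [s - d i] decreases to zero while [opabs S] takes the same value on all its terms, so
    this value is at most zero. The [d i] may have any sign, hence the modulus of [s] is bounded by
    [s - d i + fabs mu (d i)]. *)
Lemma null_ideal_net_sup S (d : I -> E) s : FLb S -> vanishing (opabs S) ->
  (forall i j, le i j -> d i <=[] d j) -> is_sup mu (fun z => exists i, z = d i) s ->
  (forall i, null_ideal mu nu S (d i)) -> null_ideal mu nu S s.
Proof.
move=> S_FLb S_van d_inc d_sup d_null.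
have A_lin := opabs_linear S_FLb; have A_pos := opabs_fpositive S_FLb.
have [[i _] _ _ _] := leI.
have le_ds : d i <=[] s by apply: d_sup.1; exists i.
have Asd_le0 : opabs S (s - d i) <={} 0.
  apply: (S_van _ (net_up_sub muE d_inc d_sup)) => j.
  have Ad0 k : opabs S (d k) = 0.
    apply: (fle_anti nuF).
      by rewrite -[X in _ <={} X](d_null k); apply: fpositive_mono => //; apply: fabs_ge.
    have := fpositive_mono A_lin A_pos (fabs_geN muR (d k)).
    rewrite (d_null k) linear_opN // => le0.
    by apply: (fle_sum1 nuF le0); lmodule.
  rewrite !linear_opB // !Ad0; exact: fle_refl nuF _.
apply: (fle_anti nuF); last by apply: A_pos; apply: fabs_ge0.
apply: (fle_trans nuF _ Asd_le0).
have -> : opabs S (s - d i) = opabs S (s - d i + fabs mu (d i)).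
  by rewrite [RHS]linear_opD // d_null addr0.
apply: fpositive_mono => //; apply: fabs_le => //.
  by apply: (fle_sum1 muE (fabs_ge muR (d i))); lmodule.
by apply: (fle_comb2 muE (ler0n _ 2) (ler0n _ 1) le_ds (fabs_geN muR (d i))); lmodule.
Qed.

Lemma vanishing_le Q U : (forall x, 0 <=[] x -> U x <={} Q x) -> vanishing Q -> vanishing U.
Proof.
move=> le_UQ Q_van y y0 g le_g; apply: (Q_van y y0) => i.
by apply: (fle_trans nuF (le_g i)); apply: le_UQ; apply: net_down0_ge0 y0.
Qed.

(** In each closure property the modulus of the new operator is dominated by an operator already
    known to vanish, or seen to vanish from the given ones. *)
Lemma op_ideal_vanishing : op_ideal mu nu (fun S => FLb S /\ vanishing (opabs S)).
Proof.
split=> [S []//||S U [S_FLb S_van] [U_FLb U_van]|a S [S_FLb S_van]|S U S_FLb le_SU [U_FLb U_van]].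
- split; first exact: FLb0.
  apply: (@vanishing_le (fun=> 0)) => [x x_ge0|y _ g le_g]; last first.
    by have [[i _] _ _ _] := leI; apply: le_g.
  apply: (@opabs_le (fun=> 0) (fun=> 0)) => //; try exact: FLb0.
    by move=> *; exact: fle_refl nuF _.
  by move=> *; rewrite oppr0; exact: fle_refl nuF _.
- have SU_FLb := FLb_add S_FLb U_FLb; split=> //.
  have AS_lin := opabs_linear S_FLb; have AS_pos := opabs_fpositive S_FLb.
  have AU_lin := opabs_linear U_FLb; have AU_pos := opabs_fpositive U_FLb.
  apply: (@vanishing_le (fun x => opabs S x + opabs U x)) => [x x_ge0|y y0 g le_g].
    apply: (@opabs_le _ (fun x => opabs S x + opabs U x)) => // [|z z_ge0|z z_ge0].
    + exact: FLb_add (opabs_FLb S_FLb) (opabs_FLb U_FLb).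
    + by apply: (fle_sum2 nuF (opabs_ge S_FLb z_ge0) (opabs_ge U_FLb z_ge0)); lmodule.
    + by apply: (fle_sum2 nuF (opabs_geN S_FLb z_ge0) (opabs_geN U_FLb z_ge0)); lmodule.
  (* An index above both [i] and [j] decouples the two terms: [g] lies below
     [opabs S (y i) + opabs U (y j)] for all [i] and [j]. *)
  apply: (S_van y y0) => i.
  suff le0 : g - opabs S (y i) <={} 0 by apply: (fle_sum1 nuF le0); lmodule.
  apply: (U_van y y0) => j.
  have [_ _ _ /(_ i j) [k [le_ik le_jk]]] := leI.
  have le_S := fpositive_mono AS_lin AS_pos (y0.1 _ _ le_ik).
  have le_U := fpositive_mono AU_lin AU_pos (y0.1 _ _ le_jk).
  apply: (fle_trans nuF _ le_U).
  by apply: (fle_sum2 nuF (le_g k) le_S); lmodule.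
- have aS_FLb := FLb_scale a S_FLb; split=> //.
  (* The summand [1] makes [b] invertible also for [a = 0]. The coefficients [(b + a) / 2] and
     [(b - a) / 2] write [b *: opabs S z - a *: S z] as a combination of [opabs S z - S z] and
     [opabs S z + S z]. *)
  pose b := `|a| + 1.
  have [lt_Nab lt_ab] : - b < a /\ a < b by apply/andP; rewrite -ltr_norml /b; lra.
  have c1_ge0 : 0 <= (b + a) / 2 by lra.
  have c2_ge0 : 0 <= (b - a) / 2 by lra.
  apply: (@vanishing_le (fun x => b *: opabs S x)) => [x x_ge0|y y0 g le_g].
    apply: (@opabs_le _ (fun x => b *: opabs S x)) => // [|z z_ge0|z z_ge0].
    + exact: FLb_scale (opabs_FLb S_FLb).
    + apply: (fle_comb2 nuF c1_ge0 c2_ge0 (opabs_ge S_FLb z_ge0) (opabs_geN S_FLb z_ge0)).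
      by lmodule_field.
    + apply: (fle_comb2 nuF c2_ge0 c1_ge0 (opabs_ge S_FLb z_ge0) (opabs_geN S_FLb z_ge0)).
      by lmodule_field.
  have b_gt0 : 0 < b by lra.
  have b_neq0 : b != 0 by exact: lt0r_neq0.
  have Vb_ge0 : 0 <= b^-1 by rewrite invr_ge0 ltW.
  have le0 : b^-1 *: g <={} 0.
    apply: (S_van y y0) => i; apply: (fle_comb1 nuF Vb_ge0 (le_g i)).
    by lmodule_field.
  by apply: (fle_comb1 nuF (ltW b_gt0) le0); lmodule_field.
- split=> //; apply: vanishing_le U_van => x /le_SU le0.
  by apply: (fle_sum1 nuF le0); lmodule.
Qed.

(* Given [y] decreasing to [0] and [x = y_i0], let [Q] be the part of [P = |T|] carried by
   the ideal generated by the [u_i = (d x - y_i)^+], which increase to [d x].  The null ideal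
   of [P - Q] contains the [u_i], hence [x], so that [P x = Q x].  Now [w <= x] and
   [w <= k u_i] force [(1 - d) w <= x - y_i], so a lower bound [g] of the [P y_i] satisfies
   [(1 - d) Q x <= P x - g], that is [g <= d P x]. *)
Lemma vanishing_null_ideals T : FLb T ->
  (forall S (u : I -> E) s, gen_ideal mu nu T S -> (forall i, 0 <=[] u i) ->
     (forall i j, le i j -> u i <=[] u j) -> is_sup mu (fun z => exists i, z = u i) s ->
     (forall i, null_ideal mu nu S (u i)) -> null_ideal mu nu S s) ->
  vanishing (opabs T).
Proof.
move=> T_FLb null_sup y y0 g le_g.
set P := opabs T in le_g *.
have P_FLb : FLb P := opabs_FLb T_FLb; have P_lin : islinear P := opabs_linear T_FLb.
have P_pos : fpositive mu nu P := opabs_fpositive T_FLb.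
have [[i0 _] le_refl le_trans le_dir] := leI; set x := y i0.
have y_ge0 i : 0 <=[] y i by exact: net_down0_ge0 y0.
apply: (dedekind_archimedean nuF (h := P x) nuDC) => n.
pose d : R := n.+2%:R^-1.
have n_gt1 : 1 < n.+2%:R :> R by rewrite ltr1n.
have d_gt0 : 0 < d by rewrite invr_gt0; lra.
have d_lt1 : d < 1 by rewrite invf_lt1; lra.
pose u i := fpos mu (d *: x - y i).
have u_ge0 i : 0 <=[] u i by exact: fpos_ge0.
have u_inc i j : le i j -> u i <=[] u j.
  by move=> le_ij; apply: fpos_mono => //; apply: (fle_sum1 muE (y0.1 _ _ le_ij)); lmodule.
have u_sup : is_sup mu (fun z => exists i, z = u i) (d *: x).
  split=> [_ [i ->]|l ub].
    apply: fpos_le => //; last exact: fge0_scale (ltW d_gt0) (y_ge0 i0).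
    by apply: (fle_sum1 muE (y_ge0 i)); lmodule.
  suff le0 : d *: x - l <=[] 0 by apply: (fle_sum1 muE le0); lmodule.
  apply: (net_down0_tail muE leI (i0 := i0) y0) => i _.
  have le_ul : u i <=[] l by apply: ub; exists i.
  by apply: (fle_sum2 muE (fpos_ge muR (d *: x - y i)) le_ul); rewrite /u; lmodule.
(* The positive cone of the ideal generated by the [u i]; a single index suffices because [u]
   increases along a directed set. *)
pose C w := 0 <=[] w /\ exists k i, 0 <= k /\ w <=[] k *: u i.
have C_cone : solid_cone C.
  split=> [|w []//|v w [v_ge0 [k [i [le0k le_v]]]] [w_ge0 [m [j [le0m le_w]]]]
          |a w lt0a [w_ge0 [k [i [le0k le_w]]]]|v w v_ge0 le_vw [w_ge0 [k [i [le0k le_w]]]]].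
  - split; first exact: fle_refl muE _.
    by exists 0, i0; rewrite scale0r; split=> //; exact: fle_refl muE _.
  - split; first exact: fge0_add.
    have [l [le_il le_jl]] := le_dir i j.
    exists (k + m), l; split; first by rewrite addr_ge0.
    have le1 := fle_trans muE le_v (fle_scale muE le0k (u_inc _ _ le_il)).
    have le2 := fle_trans muE le_w (fle_scale muE le0m (u_inc _ _ le_jl)).
    by apply: (fle_sum2 muE le1 le2); lmodule.
  - split; first by apply: fge0_scale => //; apply: ltW.
    exists (a * k), i; split; first by apply: mulr_ge0 => //; apply: ltW.
    by apply: (fle_comb1 muE (ltW lt0a) le_w); lmodule.
  - by split=> //; exists k, i; split=> //; apply: fle_trans le_w.
have [Q [Q_lin Q_pos Q_sup]] := FLb_restriction C_cone P_FLb.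
pose S z := P z - Q z.
have le_QP z : 0 <=[] z -> Q z <={} P z.
  by move=> /Q_sup [_]; apply=> _ [w [_ le_wz ->]]; apply: fpositive_mono.
have S_lin : islinear S by exact: islinear_sub.
have S_pos : fpositive mu nu S.
  by move=> z /le_QP le_QPz; apply: (fle_sum1 nuF le_QPz); rewrite /S; lmodule.
have S_FLb : FLb S by exact: fpositive_FLb.
have AS_pos := opabs_fpositive S_FLb; have AS_lin := opabs_linear S_FLb.
have le_AS z : 0 <=[] z -> opabs S z <={} S z.
  move=> z_ge0; apply: opabs_le => // v v_ge0; first exact: fle_refl nuF _.
  by apply: (fle_comb1 nuF (ler0n _ 2) (S_pos v v_ge0)); lmodule.
have S_gen : gen_ideal mu nu T S.
  split=> // J [_ _ _ _ J_solid] JT; apply: J_solid JT => // z z_ge0.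
  by apply: (fle_sum2 nuF (le_AS z z_ge0) (Q_pos z z_ge0)); rewrite /S -/P; lmodule.
have dx_null : null_ideal mu nu S (d *: x).
  apply: null_sup u_sup _ => // i; rewrite /null_ideal fabs_pos //.
  apply: (fle_anti nuF); last exact: AS_pos.
  apply: (fle_trans nuF (le_AS _ (u_ge0 i))).
  (* As [u i] belongs to [C], it competes in the supremum defining [Q (u i)]. *)
  have le_PQ : P (u i) <={} Q (u i).
    apply: (Q_sup _ (u_ge0 i)).1; exists (u i); split=> //; last exact: fle_refl muE _.
    by split=> //; exists 1, i; rewrite scale1r; split=> //; exact: fle_refl muE _.
  by apply: (fle_sum1 nuF le_PQ); rewrite /S; lmodule.
have dx_ge0 : 0 <=[] d *: x by exact: fge0_scale (ltW d_gt0) (y_ge0 i0).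
have Sdx_le0 : S (d *: x) <={} 0.
  apply: (fle_trans nuF (opabs_ge S_FLb dx_ge0)).
  by move: dx_null; rewrite /null_ideal fabs_pos // => ->; exact: fle_refl nuF _.
have Vd_gt0 : 0 < d^-1 by rewrite invr_gt0.
have d_neq0 : d != 0 by exact: lt0r_neq0.
have le_PQ : P x <={} Q x.
  apply: (fle_comb1 nuF (ltW Vd_gt0) Sdx_le0).
  by rewrite linear_opZ // /S; lmodule_field.
have c_neq0 : 1 - d != 0 by apply: lt0r_neq0; lra.
have Vc_ge0 : 0 <= (1 - d)^-1 by rewrite invr_ge0; lra.
have le_Qg : Q x <={} (1 - d)^-1 *: (P x - g).
  apply: (Q_sup x (y_ge0 i0)).2 => _ [w [[w_ge0 [k [i [le0k le_w]]]] le_wx ->]].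
  have [j [le_ij le_i0j]] := le_dir i i0.
  have le_yx : y j <=[] x by exact: y0.1.
  have le_wu := fle_trans muE le_w (fle_scale muE le0k (u_inc _ _ le_ij)).
  (* With [q = d *: x - y j], the element on the left is at most [- q] because [w <= x], and at most
     [w], hence at most [k *: fpos q]. *)
  have le_t : (1 - d) *: w - (x - y j) <=[] 0.
    apply: (fle0_disjoint muR (q := d *: x - y j) le0k).
      by apply: (fle_comb1 muE _ le_wx (a := 1 - d)); [lra|lmodule].
    have le_dw : (1 - d) *: w <=[] w by apply: (fle_comb1 muE (ltW d_gt0) w_ge0); lmodule.
    have le_t1 : (1 - d) *: w - (x - y j) <=[] w by apply: (fle_sum2 muE le_dw le_yx); lmodule.
    exact: fle_trans le_t1 le_wu.
  have le_P : P ((1 - d) *: w - (x - y j)) <={} 0.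
    by rewrite -(linear_op0 P_lin); apply: fpositive_mono.
  apply: (fle_comb2 nuF Vc_ge0 Vc_ge0 le_P (le_g j)).
  by rewrite !(linear_opD, linear_opN, linear_opZ) //; lmodule_field.
have le_P := fle_trans nuF le_PQ le_Qg.
(* Multiplying by [1 - d] gives [g <= d *: P x]; dividing by [d] then restores the factor [n.+2]. *)
apply: (fle_comb1 nuF _ le_P (a := (1 - d) / d)).
  by apply: divr_ge0; lra.
have -> : n.+2%:R = d^-1 :> R by rewrite invrK.
by lmodule_with ltac:(by field; rewrite d_neq0 c_neq0).
Qed.

Lemma net_continuous_gen_ideal T S : FLb T -> net_continuous T -> gen_ideal mu nu T S ->
  FLb S /\ vanishing (opabs S).
Proof.
move=> T_FLb T_cont [_ /(_ _ op_ideal_vanishing)]; apply.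
by split=> //; apply: vanishing_opabs.
Qed.

End Net.

End Operators.

(** * The two equivalences, for nets and for sequences *)

Theorem theorem4p7 (R : realType) (E F : lmodType R)
  (mu : E -> E -> R) (nu : F -> F -> R) (T : E -> F) :
  fuzzy_riesz mu -> fuzzy_riesz nu -> fuzzy_dedekind_complete nu ->
  FLb mu nu T ->
  (f_order_continuous mu nu T <->
     (forall S, gen_ideal mu nu T S -> fband mu (null_ideal mu nu S))) /\
  (f_sigma_order_continuous mu nu T <->
     (forall S, gen_ideal mu nu T S -> fsigma_ideal mu (null_ideal mu nu S))).
Proof.
move=> muR nuR nuDC T_FLb; have muE := muR.1.
have nat_dir : directed (fun n m => (n <= m)%N).
  split=> [|//|i j k|i j]; first by exists 0%N.
    exact: leq_trans.
  by exists (maxn i j); rewrite leq_maxl leq_maxr.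
split; split=> [T_cont S S_gen|null_S].
- split=> [|B s B_null B_sup]; first exact: null_ideal_fideal S_gen.1.
  (* For empty [B] every element is an upper bound, so [s] is the least element of [E]; comparing it
     with [0] and [s + s] gives [s = 0]. *)
  have [[b Bb]|noB] := Classical_Prop.classic (exists b, B b); last first.
    have s_min t : fle mu s t by apply: B_sup.2 => b Bb; case: noB; exists b.
    have -> : s = 0.
      by apply: (fle_anti muE) => //; apply: (fle_sum1 muE (s_min (s + s))); lmodule.
    by case: (null_ideal_fideal muR nuR nuDC S_gen.1) => -[].
  pose N := null_ideal mu nu S.
  have [[_ ND _] N_solid] := null_ideal_fideal muR nuR nuDC S_gen.1.
  (* The set [B] need not be directed. The null elements below [s] are, because a join is dominated
     by the sum of the two moduli; they include [B], so their supremum is still [s]. *)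
  pose I := {z : E | N z /\ fle mu z s}.
  pose le (i j : I) := fle mu (sval i) (sval j).
  have le_dir : directed le.
    split; first by exists (exist _ b (conj (B_null b Bb) (B_sup.1 b Bb))).
    - by move=> i; exact: fle_refl muE _.
    - by move=> i j k; apply: (fle_trans muE).
    - move=> [z [Nz le_zs]] [w [Nw le_ws]].
      have [le_z le_w lub] := fjoinP muR z w.
      suff N_join : N (fjoin mu z w).
        by exists (exist _ (fjoin mu z w) (conj N_join (lub s le_zs le_ws))).
      have abs_ge0 v : fle mu 0 (fabs mu v) by exact: fabs_ge0.
      have N_abs v : N v -> N (fabs mu v).
        by apply: N_solid; rewrite fabs_pos //; exact: fle_refl muE _.
      have sum_ge0 := fge0_add muE (abs_ge0 z) (abs_ge0 w).
      have le_z_abs := fabs_ge muR z; have le_w_abs := fabs_ge muR w.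
      apply: (N_solid _ (fabs mu z + fabs mu w)); last by apply: ND; apply: N_abs.
      rewrite [X in fle mu _ X]fabs_pos //; apply: fabs_le => //.
        apply: lub; first by apply: (fle_sum2 muE le_z_abs (abs_ge0 w)); lmodule.
        by apply: (fle_sum2 muE le_w_abs (abs_ge0 z)); lmodule.
      have le1 := fle_sum2 muE le_z (fabs_geN muR z) (x := - fjoin mu z w) (y := fabs mu z).
      apply: (fle_trans muE (le1 _)); first by lmodule.
      by apply: (fle_sum1 muE (abs_ge0 w)); lmodule.
  have [S_FLb S_van] :=
    net_continuous_gen_ideal muR nuR nuDC le_dir T_FLb (T_cont I le le_dir) S_gen.
  apply: (null_ideal_net_sup muR nuR nuDC le_dir (d := sval) S_FLb S_van) => //.
  + split=> [_ [[z [Nz le_zs]] ->]//|l ub]; apply: B_sup.2 => z Bz.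
    by apply: ub; exists (exist _ z (conj (B_null z Bz) (B_sup.1 z Bz))).
  + by case=> z [].
- have T_van (I : Type) (le : I -> I -> Prop) :
    directed le -> vanishing mu nu le (opabs mu nu T).
    move=> le_dir; apply: vanishing_null_ideals => // S u s /null_S [_ N_sup] _ _ u_sup u_null.
    by apply: N_sup u_sup => _ [i ->].
  by move=> I le le_dir; apply: net_continuous_vanishing => //; apply: T_van.
- split=> [|xs x xs_null [xs_inc xs_sup]]; first exact: null_ideal_fideal S_gen.1.
  have [S_FLb S_van] := net_continuous_gen_ideal muR nuR nuDC nat_dir T_FLb T_cont S_gen.
  by apply: (null_ideal_net_sup muR nuR nuDC nat_dir S_FLb S_van xs_inc xs_sup) => n;
    case: (xs_null n).
- apply: net_continuous_vanishing => //.
  apply: vanishing_null_ideals => // S u s /null_S [_ N_sup] u_ge0 u_inc u_sup u_null.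
  by apply: (N_sup u).
Qed.
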